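(* Let $F$ be an infinite field of characteristic different from $2$ and let $E$ be the Grassmann algebra over $F$ of a vector space of countable dimension. The algebra $M_n(E)$ (with the trivial grading) satisfies the primeness property for (ordinary) central polynomials.
   Context: $E$ is the unital associative $F$-algebra generated by $e_1,e_2,\dots$ subject to $e_ie_j=-e_je_i$ for all $i,j\geq 1$. For an associative algebra $A$, a polynomial $f(x_1,\dots,x_m)$ in the free associative algebra $F\langle X\rangle$ is an identity for $A$ if $f(a_1,\dots,a_m)=0$ for all $a_i\in A$, and a central polynomial for $A$ if it is not an identity and $f(a_1,\dots,a_m)\in Z(A)$ (the centre of $A$) for all $a_i\in A$. $A$ satisfies the primeness property for central polynomials if, whenever $f(x_1,\dots,x_r)$ and $g(x_{r+1},\dots,x_s)$ are polynomials in distinct variables such that $f\cdot g$ is a central polynomial for $A$, both $f$ and $g$ are central polynomials for $A$. *)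

(* Defs.v *)
From HB Require Import structures.
From mathcomp Require Import all_boot all_algebra.
From mathcomp Require Import ring_quotient generic_quotient.
From mathcomp Require Import finmap monalg.
From mathcomp Require Import boolp classical_sets cardinality.

Set Implicit Arguments.
Unset Strict Implicit.
Unset Printing Implicit Defensive.

Import GRing.Theory.
Local Open Scope ring_scope.
Local Open Scope quotient_scope.

(* The free unital associative algebra on countably many variables, as the
   monoid algebra of the free monoid of words over nat. *)
Notation "{ 'free' F }" := {malg F[{fmonom nat}]}
  (at level 0, F at level 2, format "{ 'free'  F }") : type_scope.

Definition freeX (F : fieldType) (i : nat) : {free F} := << fmu i >>.

Section GrassmannIdeal.
Variable F : fieldType.
Local Notation R := {free F}.

Definition anticomm_rel (i j : nat) : R :=
  freeX F i * freeX F j + freeX F j * freeX F i.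

(* Two-sided ideal generated by the anticomm_rel i j, including i = j. *)
Definition grassmann_ideal : {pred R} := fun p =>
  `[< exists s : seq (R * (nat * nat) * R),
        p = \sum_(t <- s) t.1.1 * anticomm_rel t.1.2.1 t.1.2.2 * t.2 >].

Lemma grassmann_idealP p :
  reflect (exists s : seq (R * (nat * nat) * R),
    p = \sum_(t <- s) t.1.1 * anticomm_rel t.1.2.1 t.1.2.2 * t.2)
  (p \in grassmann_ideal).
Proof. exact: asboolP. Qed.

Lemma grassmann_idealMl p q :
  q \in grassmann_ideal -> p * q \in grassmann_ideal.
Proof.
move=> /grassmann_idealP[s ->]; apply/grassmann_idealP.
exists [seq (p * t.1.1, t.1.2, t.2) | t <- s].
by rewrite big_map mulr_sumr; apply: eq_bigr => t _; rewrite !mulrA.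
Qed.

Lemma grassmann_idealMr p q :
  p \in grassmann_ideal -> p * q \in grassmann_ideal.
Proof.
move=> /grassmann_idealP[s ->]; apply/grassmann_idealP.
exists [seq (t.1, t.2 * q) | t <- s].
by rewrite big_map mulr_suml; apply: eq_bigr => t _; rewrite !mulrA.
Qed.

Lemma grassmann_ideal_zmod : zmod_closed grassmann_ideal.
Proof.
split=> [|p q /grassmann_idealP[s ->]].
  by apply/grassmann_idealP; exists [::]; rewrite big_nil.
move=> /(grassmann_idealMl (-1))/grassmann_idealP[u].
rewrite mulN1r => ->; apply/grassmann_idealP.
by exists (s ++ u); rewrite big_cat.
Qed.

Lemma grassmann_ideal1 : 1 \notin grassmann_ideal.
Proof.
apply/grassmann_idealP => -[s es]; have := congr1 (@mcoeff {fmonom nat} F mone) es.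
rewrite rmorph1 rmorph_sum big1 => [/eqP|t _]; first by rewrite oner_eq0.
have X0 i : mcoeff mone (freeX F i) = 0 by rewrite mcoeffU1 fm1_eq1.
by rewrite /= !(rmorphM, rmorphD) /= !X0 mul0r addr0 mulr0 mul0r.
Qed.

HB.instance Definition _ :=
  GRing.isZmodClosed.Build R grassmann_ideal grassmann_ideal_zmod.

End GrassmannIdeal.

Definition grassmann (F : fieldType) := Quotient.quot (@grassmann_ideal F).

HB.instance Definition _ F := GRing.Zmodule.on (grassmann F).
HB.instance Definition _ F := EqQuotient.on (grassmann F).

Section GrassmannAlgebra.
Variable F : fieldType.
Local Notation R := {free F}.
Local Notation E := (grassmann F).

Lemma grassmann_eqP (p q : R) :
  reflect (\pi_E p = \pi_E q) (p - q \in @grassmann_ideal F).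
Proof. by rewrite (Quotient.idealrBE (@grassmann_ideal F)); apply: eqP. Qed.

Lemma grassmann_reprB (p : R) : repr (\pi_E p) - p \in @grassmann_ideal F.
Proof. by apply/grassmann_eqP; rewrite reprK. Qed.

Definition grassmann_one : E := \pi_E 1.
Definition grassmann_mul : E -> E -> E := lift_op2 E *%R.
Definition grassmann_scale (c : F) : E -> E := lift_op1 E ( *:%R c).

Lemma grassmann_piD (p q : R) : \pi_E (p + q) = \pi_E p + \pi_E q.
Proof. by rewrite [RHS]piE. Qed.

Lemma grassmann_piM (p q : R) :
  \pi_E (p * q) = grassmann_mul (\pi_E p) (\pi_E q).
Proof.
unlock grassmann_mul; apply/esym/grassmann_eqP; set p' := repr _; set q' := repr _.
have -> : p' * q' - p * q = p' * (q' - q) + (p' - p) * q.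
  by rewrite mulrBr mulrBl addrA subrK.
apply: rpredD; first exact/grassmann_idealMl/grassmann_reprB.
exact/grassmann_idealMr/grassmann_reprB.
Qed.

Lemma grassmann_piZ c (p : R) : \pi_E (c *: p) = grassmann_scale c (\pi_E p).
Proof.
unlock grassmann_scale; apply/esym/grassmann_eqP; rewrite -scalerBr -mul_malgC.
exact/grassmann_idealMl/grassmann_reprB.
Qed.

Lemma grassmann_mulA : associative grassmann_mul.
Proof.
by move=> x y z; rewrite -[x]reprK -[y]reprK -[z]reprK -!grassmann_piM mulrA.
Qed.

Lemma grassmann_mul1l : left_id grassmann_one grassmann_mul.
Proof. by move=> x; rewrite -[x]reprK -grassmann_piM mul1r. Qed.

Lemma grassmann_mul1r : right_id grassmann_one grassmann_mul.
Proof. by move=> x; rewrite -[x]reprK -grassmann_piM mulr1. Qed.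

Lemma grassmann_mulDl : left_distributive grassmann_mul +%R.
Proof.
move=> x y z; rewrite -[x]reprK -[y]reprK -[z]reprK.
by rewrite -grassmann_piD -!grassmann_piM mulrDl grassmann_piD.
Qed.

Lemma grassmann_mulDr : right_distributive grassmann_mul +%R.
Proof.
move=> x y z; rewrite -[x]reprK -[y]reprK -[z]reprK.
by rewrite -grassmann_piD -!grassmann_piM mulrDr grassmann_piD.
Qed.

Lemma grassmann_one_neq0 : grassmann_one != 0.
Proof.
have -> : 0 = \pi_E 0 :> E by rewrite [LHS]piE.
by apply/eqP => /grassmann_eqP; rewrite subr0 (negPf (grassmann_ideal1 F)).
Qed.

HB.instance Definition _ := GRing.Zmodule_isNzRing.Build E
  grassmann_mulA grassmann_mul1l grassmann_mul1r
  grassmann_mulDl grassmann_mulDr grassmann_one_neq0.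

Lemma grassmann_scaleA a b x :
  grassmann_scale a (grassmann_scale b x) = grassmann_scale (a * b) x.
Proof. by rewrite -[x]reprK -!grassmann_piZ scalerA. Qed.

Lemma grassmann_scale1 : left_id 1 grassmann_scale.
Proof. by move=> x; rewrite -[x]reprK -grassmann_piZ scale1r. Qed.

Lemma grassmann_scaleDr : right_distributive grassmann_scale +%R.
Proof.
move=> a x y; rewrite -[x]reprK -[y]reprK.
by rewrite -grassmann_piD -!grassmann_piZ scalerDr grassmann_piD.
Qed.

Lemma grassmann_scaleDl x :
  {morph grassmann_scale^~ x : a b / a + b}.
Proof.
by move=> a b; rewrite -[x]reprK -!grassmann_piZ scalerDl grassmann_piD.
Qed.

HB.instance Definition _ := GRing.Zmodule_isLmodule.Build F E
  grassmann_scaleA grassmann_scale1 grassmann_scaleDr grassmann_scaleDl.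

Lemma grassmann_scaleAl (a : F) (x y : E) : a *: (x * y) = a *: x * y.
Proof.
rewrite -[x]reprK -[y]reprK -[LHS]/(grassmann_scale _ (grassmann_mul _ _)).
rewrite -[RHS]/(grassmann_mul (grassmann_scale _ _) _).
by rewrite -!(grassmann_piM, grassmann_piZ) scalerAl.
Qed.

HB.instance Definition _ :=
  GRing.Lmodule_isLalgebra.Build F E grassmann_scaleAl.

Lemma free_scaleAr (a : F) (p q : R) : a *: (p * q) = p * (a *: q).
Proof.
apply/malgP => k; rewrite mcoeffZ !(mcoeffMlw k (d1 := msupp p) (d2 := msupp q)) //.
  rewrite mulr_sumr; apply: eq_bigr => k1 _; rewrite mulr_sumr.
  by apply: eq_bigr => k2 _; rewrite mcoeffZ mulrnAr mulrCA.
exact: msuppZ_le.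
Qed.

Lemma grassmann_scaleAr (a : F) (x y : E) : a *: (x * y) = x * (a *: y).
Proof.
rewrite -[x]reprK -[y]reprK -[LHS]/(grassmann_scale _ (grassmann_mul _ _)).
rewrite -[RHS]/(grassmann_mul _ (grassmann_scale _ _)).
by rewrite -!(grassmann_piM, grassmann_piZ) free_scaleAr.
Qed.

HB.instance Definition _ :=
  GRing.Lalgebra_isAlgebra.Build F E grassmann_scaleAr.

End GrassmannAlgebra.

Definition grassmann_gen (F : fieldType) (i : nat) : grassmann F :=
  \pi_(grassmann F) (freeX F i).

Lemma grassmann_gen_anticomm (F : fieldType) (i j : nat) :
  grassmann_gen F i * grassmann_gen F j
    = - (grassmann_gen F j * grassmann_gen F i).
Proof.
have genM k l : grassmann_gen F k * grassmann_gen F l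
    = \pi_(grassmann F) (freeX F k * freeX F l) by rewrite grassmann_piM.
apply/eqP; rewrite -addr_eq0 !genM -grassmann_piD; apply/eqP.
have -> : 0 = \pi_(grassmann F) 0 by rewrite [LHS]piE.
apply/grassmann_eqP/grassmann_idealP; exists [:: (1, (i, j), 1)].
by rewrite big_seq1 /= subr0 mul1r mulr1.
Qed.

(* 'M[A]_n.+1 is natively a module over A; this alias carries instead the
   F-algebra structure inherited from A. The size is n.+1 because algebras are
   nontrivial rings in the library. *)
Definition matrix_alg (F : fieldType) (A : algType F) (n : nat) :=
  'M[A]_n.+1.

Section MatrixAlgebra.
Variables (F : fieldType) (A : algType F) (n : nat).
Local Notation M := (matrix_alg A n).

HB.instance Definition _ := GRing.NzRing.on M.

Definition matrix_alg_scale (c : F) (x : M) : M := map_mx ( *:%R c) x.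

Lemma matrix_alg_scaleA a b x :
  matrix_alg_scale a (matrix_alg_scale b x) = matrix_alg_scale (a * b) x.
Proof. by apply/matrixP => i j; rewrite !mxE scalerA. Qed.

Lemma matrix_alg_scale1 : left_id 1 matrix_alg_scale.
Proof. by move=> x; apply/matrixP => i j; rewrite !mxE scale1r. Qed.

Lemma matrix_alg_scaleDr : right_distributive matrix_alg_scale +%R.
Proof. by move=> a x y; apply/matrixP => i j; rewrite !mxE scalerDr. Qed.

Lemma matrix_alg_scaleDl x : {morph matrix_alg_scale^~ x : a b / a + b}.
Proof. by move=> a b; apply/matrixP => i j; rewrite !mxE scalerDl. Qed.

HB.instance Definition _ := GRing.Zmodule_isLmodule.Build F M
  matrix_alg_scaleA matrix_alg_scale1 matrix_alg_scaleDr matrix_alg_scaleDl.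

Lemma matrix_alg_scaleAl (a : F) (x y : M) : a *: (x * y) = a *: x * y.
Proof.
apply/matrixP => i j; rewrite !mxE scaler_sumr.
by apply: eq_bigr => k _; rewrite !mxE scalerAl.
Qed.

HB.instance Definition _ :=
  GRing.Lmodule_isLalgebra.Build F M matrix_alg_scaleAl.

Lemma matrix_alg_scaleAr (a : F) (x y : M) : a *: (x * y) = x * (a *: y).
Proof.
apply/matrixP => i j; rewrite !mxE scaler_sumr.
by apply: eq_bigr => k _; rewrite !mxE scalerAr.
Qed.

HB.instance Definition _ :=
  GRing.Lalgebra_isAlgebra.Build F M matrix_alg_scaleAr.

End MatrixAlgebra.

Section CentralPolynomials.
Variables (F : fieldType) (A : algType F).

Definition free_eval (a : nat -> A) (f : {free F}) : A :=
  mmap (in_alg A) (fun w : {fmonom nat} => \prod_(i <- w) a i) f.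

Definition identity_for (f : {free F}) : Prop :=
  forall a : nat -> A, free_eval a f = 0.

Definition in_center (z : A) : Prop := forall b : A, z * b = b * z.

Definition central_polynomial (f : {free F}) : Prop :=
  ~ identity_for f /\ forall a : nat -> A, in_center (free_eval a f).

Definition in_variables (D : pred nat) (f : {free F}) : Prop :=
  forall w : {fmonom nat}, w \in msupp f -> all D w.

(* Variables are numbered from 0. *)
Definition primeness_central : Prop :=
  forall (r s : nat) (f g : {free F}),
    in_variables (fun i => i < r)%N f ->
    in_variables (fun i => r <= i < s)%N g ->
    central_polynomial (f * g) ->
    central_polynomial f /\ central_polynomial g.

End CentralPolynomials.

(* Main.v *)
From HB Require Import structures.
Require Import Defs.
From mathcomp Require Import all_boot all_algebra.
From mathcomp Require Import perm generic_quotient finmap monalg.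
From mathcomp Require Import boolp classical_sets cardinality.

(* Let L be the set of x such that x g(b) is central for all b. It contains the
   values of f, and it is an additive group stable under conjugation, because
   the values of g are stable under automorphisms. When f(a) and g(b) are
   nonzero in E, substituting generators of large index in b makes f(a) g(b)
   nonzero.
   For i <> j, conjugation of x in L by 1 + E_ij and 1 - E_ij puts 2 x_ji E_ij
   in L; the only central matrix with a single nonzero row is 0, so x_ji = 0.
   With x diagonal, conjugation by 1 + u E_ij gives u x_jj = x_ii u, so for
   matrices of size at least 2, x is a scalar matrix over the centre of E.
   In size 1, conjugation by 1 + e_k puts the central element [e_k, x] in L;
   if it is nonzero then all g(b) are central, and then so is x. *)

Set Implicit Arguments.
Unset Strict Implicit.
Unset Printing Implicit Defensive.

Import GRing.Theory.
Local Open Scope ring_scope.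
Local Open Scope quotient_scope.

(** * Evaluation of noncommutative polynomials *)

Lemma freeX_rcons (F : fieldType) (s : seq nat) (i : nat) :
  << FMonom (rcons s i) >> = << FMonom s >> * freeX F i.
Proof.
rewrite malgM_def fgmulUU mulr1; congr << _ >>.
by apply/val_inj; rewrite /= fmM fmU cats1.
Qed.

Section FreeEval.
Variables (F : fieldType) (A : algType F).
Implicit Types (a : nat -> A) (p q : {free F}).

Definition word_eval a (w : {fmonom nat}) : A := \prod_(i <- w) a i.

Lemma word_eval_is_mmorphism a : mmorphism (word_eval a).
Proof.
split=> [v w|]; first by rewrite /word_eval fmM big_cat.
by rewrite /word_eval fm1 big_nil.
Qed.

HB.instance Definition _ a :=
  isMultiplicative.Build _ _ (word_eval a) (word_eval_is_mmorphism a).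

Lemma free_evalE a p : free_eval a p = mmap (in_alg A) (word_eval a) p.
Proof. by []. Qed.

Lemma free_evalD a : {morph free_eval a : p q / p + q}.
Proof. exact: mmapD. Qed.

Lemma free_eval0 a : free_eval a 0 = 0.
Proof. exact: mmap0. Qed.

Lemma free_evalM a : {morph free_eval a : p q / p * q}.
Proof.
apply: (commr_mmap_is_multiplicative (f := in_alg A) (h := word_eval a) _).1.
by move=> p v w; rewrite /GRing.comm /= mulr_algl mulr_algr.
Qed.

Lemma free_eval1 a : free_eval a 1 = 1.
Proof. by rewrite free_evalE mmap1. Qed.

Lemma free_evalZ a c p : free_eval a (c *: p) = c *: free_eval a p.
Proof. by rewrite !free_evalE mmapZ /= mulr_algl. Qed.

Lemma free_evalX a i : free_eval a (freeX F i) = a i.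
Proof. by rewrite free_evalE mmapU /= scale1r mul1r /word_eval fmU big_seq1. Qed.

Lemma free_eval_anticomm a i j :
  free_eval a (anticomm_rel F i j) = a i * a j + a j * a i.
Proof.
by rewrite free_evalD; congr (_ + _); rewrite free_evalM !free_evalX.
Qed.

Lemma eq_free_eval (D : pred nat) a b p :
  in_variables D p -> {in D, a =1 b} -> free_eval a p = free_eval b p.
Proof.
move=> Dp eq_ab; rewrite !free_evalE !mmapE; apply: eq_big_seq => w pw.
congr (_ * _); apply: eq_big_seq => i wi; apply: eq_ab.
by have /allP := Dp _ pw; apply.
Qed.

End FreeEval.

(** This makes the set of values of a polynomial stable under all endomorphisms, both conjugations
    and substitutions of generators. *)
Lemma free_eval_morph (F : fieldType) (A B : algType F)
    (phi : {lrmorphism A -> B}) (a : nat -> A) (p : {free F}) :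
  phi (free_eval a p) = free_eval (phi \o a) p.
Proof.
rewrite !free_evalE !mmapE rmorph_sum; apply: eq_bigr => w _.
by rewrite rmorphM /= linearZ rmorph1 rmorph_prod.
Qed.

(** * Two-by-two matrices satisfying the Grassmann relations *)

Section TwoByTwo.
Variable R : nzRingType.
Implicit Types (x y : R).

(** The sign makes this matrix anticommute with the matrix unit [delta_mx 1 0]. *)
Definition signed_diag x : 'M[R]_2 :=
  \matrix_(r, c) (if r == c then if r == 0 then x else - x else 0).

Lemma signed_diag_anticomm x y : x * y = - (y * x) ->
  signed_diag x *m signed_diag y = - (signed_diag y *m signed_diag x).
Proof.
move=> xyN; apply/matrixP => r c; rewrite !mxE !big_ord_recl !big_ord0 !mxE.
by case: r c => -[|[]] // ? [[|[]] // ?] /=;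
  rewrite ?mulrNN ?(mulr0, mul0r, add0r, addr0, oppr0).
Qed.

Lemma delta_signed_diag_anticomm x :
  delta_mx 1 0 *m signed_diag x = - (signed_diag x *m delta_mx 1 0).
Proof.
apply/matrixP => r c; rewrite !mxE !big_ord_recl !big_ord0 !mxE.
by case: r c => -[|[]] // ? [[|[]] // ?] /=;
  rewrite ?(mulr0, mul0r, mulr1, mul1r, add0r, addr0, oppr0, opprK).
Qed.

Lemma mul_signed_diag (M : 'M[R]_2) x :
  ((M *m signed_diag x) 0 0 = M 0 0 * x) *
  ((M *m signed_diag x) 0 1 = - (M 0 1 * x)).
Proof.
split; rewrite !mxE !big_ord_recl !big_ord0 !mxE /= ?(mulr0, add0r, addr0) //.
by rewrite mulrN; congr (- (M _ _ * _)); apply/val_inj.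
Qed.

Lemma mul_delta_10 (M : 'M[R]_2) : ((delta_mx 1 0 : 'M_2) *m M) 1 0 = M 0 0.
Proof. by rewrite mxE !big_ord_recl big_ord0 !mxE /= mul1r mul0r !addr0. Qed.

End TwoByTwo.

(** * The Grassmann algebra: universal property, centre, products in disjoint generators *)

Section Grassmann.
Variable F : fieldType.
Local Notation E := (grassmann F).
Local Notation e := (grassmann_gen F).
Implicit Types (x y z : E).

(** Classes of words span [E], and every word arises by appending letters on the right. *)
Lemma grassmann_ind (P : E -> Prop) :
  P 1 -> (forall x y, P x -> P y -> P (x + y)) ->
  (forall c x, P x -> P (c *: x)) -> (forall x i, P x -> P (x * e i)) ->
  forall x, P x.
Proof.
move=> P1 PD PZ PM x; rewrite -[x]reprK.
have P0 : P 0 by rewrite -(scale0r (1 : E)); apply: PZ.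
have Pw (w : {fmonom nat}) : P (\pi_E << w >>).
  case: w => s; elim/last_ind: s => [|s i IHs].
    by rewrite -fmoneE.
  rewrite freeX_rcons grassmann_piM; exact: PM.
rewrite [repr x]monalgE; elim/big_rec: _ => [|w p _ Pp].
  by have -> : \pi_E 0 = 0 :> E by rewrite [RHS]piE.
rewrite grassmann_piD; apply: PD => //.
have -> : << (repr x)@_w *g w >> = (repr x)@_w *: << w >>.
  by apply/malgP => k; rewrite mcoeffZ !mcoeffU mulr_natr.
rewrite grassmann_piZ; exact: PZ.
Qed.

(** Evaluation at [v] kills the anticommutators, hence the whole ideal, and so does not depend on
    the representative. *)
Lemma grassmann_universal (A : algType F) (v : nat -> A) :
  (forall i j, v i * v j = - (v j * v i)) ->
  exists phi : {lrmorphism E -> A}, forall i, phi (e i) = v i.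
Proof.
move=> vN; have rel0 i j : free_eval v (anticomm_rel F i j) = 0.
  by rewrite free_eval_anticomm vN addNr.
pose phi x := free_eval v (repr x).
have phi_pi p : phi (\pi_E p) = free_eval v p.
  rewrite /phi -[LHS](subrK (free_eval v p)) -[X in _ - X]scale1r.
  rewrite -scaleNr -free_evalZ -free_evalD scaleN1r.
  have /grassmann_idealP[s ->] := grassmann_reprB p.
  elim/big_rec: _ => [|t q _]; first by rewrite free_eval0 add0r.
  by rewrite free_evalD free_evalM (free_evalM v t.1.1) rel0 mulr0 mul0r add0r.
have phiD : zmod_morphism phi.
  move=> x y; rewrite -[x]reprK -[y]reprK -scaleN1r.
  rewrite -[_ *: _]/(grassmann_scale _ _) -grassmann_piZ -grassmann_piD.
  by rewrite !phi_pi free_evalD free_evalZ scaleN1r.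
have phiM : monoid_morphism phi.
  split=> [|x y]; first by rewrite -[1]/(\pi_E 1) phi_pi free_eval1.
  by rewrite -[x]reprK -[y]reprK -[_ * _]grassmann_piM !phi_pi free_evalM.
have phiZ : scalable phi.
  by move=> c x; rewrite -[x]reprK -[_ *: _]grassmann_piZ !phi_pi free_evalZ.
pose a := GRing.isZmodMorphism.Build _ _ phi phiD.
pose b := GRing.isMonoidMorphism.Build _ _ phi phiM.
pose c := GRing.isScalable.Build _ _ _ _ phi phiZ.
pose psi : {lrmorphism E -> A} := HB.pack phi a b c.
by exists psi => i; rewrite -[e i]/(\pi_E _) [LHS]phi_pi free_evalX.
Qed.

Lemma grassmann_morph_eq (A : algType F) (phi psi : {lrmorphism E -> A}) :
  (forall i, phi (e i) = psi (e i)) -> phi =1 psi.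
Proof.
move=> eq_e; apply: grassmann_ind => [|x y IHx IHy|c x IHx|x i IHx].
- by rewrite !rmorph1.
- by rewrite !rmorphD /= IHx IHy.
- by rewrite !linearZ /= IHx.
- by rewrite !rmorphM /= IHx eq_e.
Qed.

(* [y] is the image of [x] under the parity automorphism. *)
Lemma grassmann_twist x : exists y,
  forall k, e k * x = y * e k /\ e k * y = x * e k.
Proof.
elim/grassmann_ind: x => [|x y [x' IHx] [y' IHy]|c x [x' IHx]|x i [x' IHx]].
- by exists 1 => k; rewrite mulr1 mul1r.
- exists (x' + y') => k; have [xk x'k] := IHx k; have [yk y'k] := IHy k.
  by rewrite !mulrDr !mulrDl xk yk x'k y'k.
- exists (c *: x') => k; have [xk x'k] := IHx k.
  by rewrite -!scalerAr -!scalerAl xk x'k.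
- exists (- (x' * e i)) => k; have [xk x'k] := IHx k.
  rewrite mulrN !mulNr !mulrA xk x'k -!mulrA.
  by rewrite [e k * e i]grassmann_gen_anticomm !mulrN opprK.
Qed.

Lemma grassmann_central x :
  (forall k, e k * x = x * e k) -> in_center x.
Proof.
move=> xC; elim/grassmann_ind => [|y z IHy IHz|c y IHy|y i IHy].
- by rewrite mulr1 mul1r.
- by rewrite mulrDr mulrDl IHy IHz.
- by rewrite -scalerAr -scalerAl IHy.
- by rewrite mulrA IHy -!mulrA xC.
Qed.

(** With [y] the parity image of [x], the bracket is [(y - x) * e k], a product of two odd elements,
    hence even. *)
Lemma grassmann_bracket_central x k : in_center (e k * x - x * e k).
Proof.
have [y xy] := grassmann_twist x; apply: grassmann_central => l.
have [-> _] := xy k; have [lx ly] := xy l.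
rewrite mulrBr mulrBl !mulrA lx ly -!mulrA grassmann_gen_anticomm.
by rewrite !mulrN opprK addrC.
Qed.

Hypothesis Fchar : 2%N \notin [pchar F].

Lemma two_unit : (2%:R : F) != 0.
Proof. by apply: contra Fchar => F2; rewrite inE /= F2. Qed.

Lemma addrr_eq0 (V : lmodType F) (v : V) : v + v = 0 -> v = 0.
Proof.
move=> /eqP; rewrite -mulr2n -scaler_nat scaler_eq0 (negPf two_unit).
by move/eqP.
Qed.

(** The defining relation for equal indices only says that twice the square vanishes. *)
Lemma grassmann_gen_sq k : e k * e k = 0.
Proof. by apply: addrr_eq0; rewrite {1}grassmann_gen_anticomm addNr. Qed.

Lemma grassmann_gen_sandwich k x : e k * x * e k = 0.
Proof.
have [y xy] := grassmann_twist x; have [-> _] := xy k.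
by rewrite -mulrA grassmann_gen_sq mulr0.
Qed.

(** The subalgebra generated by the first [N] generators, in a form adapted to induction: the last
    generator is split off. Uniqueness of the two components is not claimed. *)
Fixpoint genspan N : E -> Prop :=
  if N is N'.+1 then
    fun x => exists y z, [/\ genspan N' y, genspan N' z & x = y + z * e N']
  else fun x => exists c, x = c%:A.

Lemma genspan0 N : genspan N 0.
Proof.
elim: N => [|N IHN] /=; first by exists 0; rewrite scale0r.
by exists 0, 0; rewrite mul0r addr0.
Qed.

Lemma genspan_leq M N x : (M <= N)%N -> genspan M x -> genspan N x.
Proof.
move=> /subnK <-; elim: (N - M)%N => [|d IHd] //= /IHd Mx.
by exists x, 0; rewrite mul0r addr0; split=> //; apply: genspan0.
Qed.

Lemma genspanD N x y : genspan N x -> genspan N y -> genspan N (x + y).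
Proof.
elim: N x y => [|N IHN] x y /=.
  by move=> [c ->] [d ->]; exists (c + d); rewrite scalerDl.
move=> [x1 [x2 [? ? ->]]] [y1 [y2 [? ? ->]]]; exists (x1 + y1), (x2 + y2).
by rewrite mulrDl addrACA; split=> //; apply: IHN.
Qed.

Lemma genspanZ N c x : genspan N x -> genspan N (c *: x).
Proof.
elim: N x => [|N IHN] x /=.
  by move=> [d ->]; exists (c * d); rewrite scalerA.
move=> [x1 [x2 [? ? ->]]]; exists (c *: x1), (c *: x2).
by rewrite scalerDr scalerAl; split=> //; apply: IHN.
Qed.

(** For the last index, the component along [e N] is killed by the square; a generator of smaller
    index passes [e N] at the cost of a sign. *)
Lemma genspan_gen N x k : (k < N)%N -> genspan N x -> genspan N (x * e k).
Proof.
elim: N x => //= N IHN x; rewrite ltnS leq_eqVlt => /orP[/eqP-> | ltkN].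
  move=> [x1 [x2 [? ? ->]]]; exists 0, x1; split=> //; first exact: genspan0.
  by rewrite mulrDl -mulrA grassmann_gen_sq mulr0 add0r addr0.
move=> [x1 [x2 [? ? ->]]]; exists (x1 * e k), ((-1) *: (x2 * e k)); split.
- exact: IHN.
- by apply: genspanZ; apply: IHN.
- rewrite mulrDl -mulrA [e N * e k]grassmann_gen_anticomm.
  by rewrite mulrN mulrA scaleN1r mulNr.
Qed.

Lemma genspan_total x : exists N, genspan N x.
Proof.
elim/grassmann_ind: x => [|x y [M Mx] [N Ny]|c x [M Mx]|x i [M Mx]].
- by exists 0%N, 1; rewrite scale1r.
- exists (maxn M N); apply: genspanD.
    exact: genspan_leq (leq_maxl _ _) Mx.
  exact: genspan_leq (leq_maxr _ _) Ny.
- by exists M; apply: genspanZ.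
- exists (maxn M i.+1); apply: genspan_gen; first exact: leq_maxr.
  exact: genspan_leq (leq_maxl _ _) Mx.
Qed.

(** Applying such a map to a relation erases the terms that contain [e N]. *)
Lemma grassmann_kill N : exists phi : {lrmorphism E -> E},
  phi (e N) = 0 /\ (forall i, i != N -> phi (e i) = e i).
Proof.
have [i j|phi phiE] :=
  @grassmann_universal E (fun i => if i == N then 0 else e i).
  by do 2?case: eqP => _; rewrite ?mulr0 ?mul0r ?oppr0 // grassmann_gen_anticomm.
exists phi; split; first by rewrite phiE eqxx.
by move=> i /negPf iN; rewrite phiE iN.
Qed.

Lemma genspan_fixed N x (phi : {lrmorphism E -> E}) :
  (forall i, (i < N)%N -> phi (e i) = e i) -> genspan N x -> phi x = x.
Proof.
elim: N x => [|N IHN] x phie /=.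
  by move=> [c ->]; rewrite linearZ rmorph1.
move=> [y [z [Ny Nz ->]]]; rewrite rmorphD rmorphM /= phie //.
by rewrite !IHN // => i iN; rewrite phie // ltnW.
Qed.

(* With [e 0] sent to a matrix unit and [e i.+1] to diag(e i, - e i), the
   entries of a 2 x 2 matrix recover [y] from the shift of [y], even after
   multiplication by [e 0]. *)
Lemma grassmann_shift : exists sh : {lrmorphism E -> E},
  [/\ forall i, sh (e i) = e i.+1, forall y, sh y = 0 -> y = 0
    & forall y, e 0%N * sh y = 0 -> y = 0].
Proof.
have [i j|sh shE] := @grassmann_universal E (fun i => e i.+1).
  exact: grassmann_gen_anticomm.
pose v i : matrix_alg E 1 :=
  if i is i'.+1 then signed_diag (e i') else delta_mx 1 0.
have v00 : v 0%N * v 0%N = 0 by exact: mul_delta_mx_0.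
have [|psi psiE] := @grassmann_universal (matrix_alg E 1) v.
  move=> [|i] [|j].
  - by rewrite v00 oppr0.
  - exact: delta_signed_diag_anticomm.
  - by apply/eqP; rewrite -eqr_oppLR; apply/eqP/esym/delta_signed_diag_anticomm.
  - exact/signed_diag_anticomm/grassmann_gen_anticomm.
(* Right multiplication acts on each row separately, so the induction only follows row 0. *)
have sh_diag y : psi (sh y) 0 0 = y /\ psi (sh y) 0 1 = 0.
  elim/grassmann_ind: y => [|x y [x0 x1] [y0 y1]|c x [x0 x1]|x i [x0 x1]].
  - by rewrite !rmorph1 !mxE.
  - by rewrite !rmorphD !mxE x0 x1 y0 y1 addr0.
  - by rewrite !linearZ !mxE x0 x1 scaler0.
  - have -> : psi (sh (x * e i)) = psi (sh x) * v i.+1.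
      by rewrite !rmorphM /= shE psiE.
    have [xe0 xe1] := mul_signed_diag (psi (sh x)) (e i).
    split; [apply: etrans xe0 _ | apply: etrans xe1 _].
      by rewrite x0.
    by rewrite x1 mul0r oppr0.
exists sh; split=> // y sh0.
  by rewrite -(sh_diag y).1 sh0 rmorph0 mxE.
have : psi (e 0%N * sh y) 1 0 = 0 by rewrite sh0 rmorph0 mxE.
rewrite rmorphM /= psiE => <-.
by rewrite -[LHS](sh_diag y).1; apply/esym/mul_delta_10.
Qed.

(** When [x] involves only the first [N] generators, [phi] shifts indices by [N], so that [x] and
    [phi y] have no generator in common. The induction on [N] splits off the last generator of
    [x]. *)
Lemma grassmann_disjoint x : x != 0 ->
  exists phi : {lrmorphism E -> E}, forall y, x * phi y = 0 -> y = 0.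
Proof.
have [sh [she sh_inj sh_inj0]] := grassmann_shift.
suff key N : exists phi : {lrmorphism E -> E},
    (forall i, phi (e i) = e (N + i)%N) /\
    forall x, genspan N x -> x != 0 -> forall y, x * phi y = 0 -> y = 0.
  have [N Nx] := genspan_total x => x0; have [phi [_ phi_reg]] := key N.
  by exists phi => y; apply: phi_reg.
elim: N => [|N [phi [phie IHN]]].
  exists idfun; split=> // {}x /= [c ->] c0 y /eqP.
  rewrite mulr_algl scaler_eq0 => /orP[/eqP c_eq0|/eqP //].
  by rewrite c_eq0 scale0r eqxx in c0.
exists (phi \o sh); split=> [i|_ [u [v [Nu Nv ->]]] uv0 y] /=.
  by rewrite she phie addnS.
(* Killing [e N] isolates the part [u] free of it, since [phi (sh y)] involves only indices beyond
   [N]. *)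
have [eps [epsN epse]] := grassmann_kill N.
have eps_fix: eps (phi (sh y)) = phi (sh y).
  apply: (@grassmann_morph_eq _ (eps \o (phi \o sh)) (phi \o sh)) => i /=.
  by rewrite she phie epse // addnS -addSn neq_ltn leq_addr orbT.
have eps_u: eps u = u.
  by apply: genspan_fixed Nu => i iN; rewrite epse // neq_ltn iN.
move=> uvy; have uy : u * phi (sh y) = 0.
  have := congr1 eps uvy.
  by rewrite rmorphM rmorphD rmorphM /= epsN mulr0 addr0 eps_fix eps_u rmorph0.
(* If [u] is zero, [e N] is absorbed as [phi (e 0)]: the induction hypothesis applies to [v] and
   [e 0 * sh y]. *)
have [u0|u0] := eqVneq u 0; last by apply: sh_inj; apply: IHN uy.
move: uv0 uvy; rewrite u0 add0r => ve0 vey.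
have v0 : v != 0 by apply: contraNneq ve0 => ->; rewrite mul0r.
by apply/sh_inj0/(IHN v) => //; rewrite rmorphM /= phie addn0 mulrA.
Qed.

End Grassmann.

(** * Elementary matrices over a noncommutative ring *)

Section ElementaryMatrices.
Variables (R : nzRingType) (m : nat).
Implicit Types (u : R) (x : 'M[R]_m).

Definition elem_mx i j u : 'M[R]_m :=
  \matrix_(a, b) (u *+ ((a == i) && (b == j))).

Lemma mul_elem_mx i j u x a b :
  (elem_mx i j u *m x) a b = (u * x j b) *+ (a == i).
Proof.
rewrite mxE (bigD1 j) //= big1 => [|c /negPf cj].
  by rewrite mxE eqxx andbT addr0 mulrnAl.
by rewrite mxE cj andbF mul0r.
Qed.

Lemma mul_mx_elem i j u x a b :
  (x *m elem_mx i j u) a b = (x a i * u) *+ (b == j).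
Proof.
rewrite mxE (bigD1 i) //= big1 => [|c /negPf ci].
  by rewrite mxE eqxx addr0 mulrnAr.
by rewrite mxE ci mulr0.
Qed.

(** Off-diagonal positions serve sizes at least 2; a square-zero entry also allows a diagonal
    position, the only one in size 1. *)
Lemma elem_mx_sq i j u : u * u = 0 \/ i != j ->
  elem_mx i j u *m elem_mx i j u = 0.
Proof.
move=> uij; apply/matrixP => a b; rewrite mul_elem_mx !mxE.
case: uij => [uu|/negPf ij]; first by rewrite mulrnAr uu !mul0rn.
by rewrite eq_sym ij mulr0 mul0rn.
Qed.

Lemma elem_mx_sandwich i j k l u v x :
  elem_mx i j u *m x *m elem_mx k l v = elem_mx i l (u * x j k * v).
Proof.
apply/matrixP => a b.
by rewrite mul_mx_elem mul_elem_mx mxE mulrnAl -mulrnA mulnb.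
Qed.

End ElementaryMatrices.

(** * Endomorphisms and centre of matrix algebras *)

Lemma conj_lrmorphism (F : fieldType) (B : algType F) (u v : B) :
  u * v = 1 -> v * u = 1 ->
  exists phi : {lrmorphism B -> B}, forall x, phi x = u * x * v.
Proof.
move=> uv vu; pose phi (x : B) := u * x * v.
have phiD : zmod_morphism phi by move=> x y; rewrite /phi mulrBr mulrBl.
have phiM : monoid_morphism phi.
  split=> [|x y]; rewrite /phi; first by rewrite mulr1.
  by rewrite !mulrA -[_ * v * u]mulrA vu mulr1.
have phiZ : scalable phi by move=> c x; rewrite /phi -scalerAr -scalerAl.
pose a := GRing.isZmodMorphism.Build _ _ phi phiD.
pose b := GRing.isMonoidMorphism.Build _ _ phi phiM.
pose c := GRing.isScalable.Build _ _ _ _ phi phiZ.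
pose psi : {lrmorphism B -> B} := HB.pack phi a b c.
by exists psi.
Qed.

Section MatrixAlg.
Variables (F : fieldType) (A : algType F) (n : nat).
Local Notation M := (matrix_alg A n).
Implicit Types (x y z : M).

Lemma map_mx_lrmorphism (phi : {lrmorphism A -> A}) :
  exists Phi : {lrmorphism M -> M}, forall x i j, Phi x i j = phi (x i j).
Proof.
pose Phi x : M := map_mx phi x.
have PhiD : zmod_morphism Phi.
  by move=> x y; apply/matrixP => i j; rewrite !mxE rmorphB.
have PhiM : monoid_morphism Phi.
  split=> [|x y]; first exact: map_mx1.
  exact: map_mxM.
have PhiZ : scalable Phi.
  by move=> c x; apply/matrixP => i j; rewrite !mxE linearZ.
pose a := GRing.isZmodMorphism.Build _ _ Phi PhiD.
pose b := GRing.isMonoidMorphism.Build _ _ Phi PhiM.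
pose c := GRing.isScalable.Build _ _ _ _ Phi PhiZ.
pose psi : {lrmorphism M -> M} := HB.pack Phi a b c.
by exists psi => x i j; rewrite [LHS]mxE.
Qed.

(** Commutation with the matrix unit [E_j0] already forces this: compare the entries in position
    [(i, 0)]. *)
Lemma central_entry z i j : in_center z -> z i j = z 0 0 *+ (i == j).
Proof.
move=> /(_ (elem_mx j 0 1)) zC.
have := congr1 (fun w : M => w i 0) zC.
rewrite [X in X = _ -> _]mul_mx_elem [X in _ = X -> _]mul_elem_mx.
by rewrite mulr1 mul1r.
Qed.

Lemma central_scalar z (c : A) :
  in_center c -> (forall i j, z i j = c *+ (i == j)) -> in_center z.
Proof.
move=> cC zE x; apply/matrixP => i j.
transitivity (c * x i j); last rewrite cC.
  rewrite mxE (bigD1 i) //= zE eqxx big1 ?addr0 // => k /negPf ki.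
  by rewrite zE eq_sym ki mul0r.
rewrite mxE (bigD1 j) //= zE eqxx big1 ?addr0 // => k /negPf kj.
by rewrite zE kj mulr0.
Qed.

End MatrixAlg.

(** * Conjugation by [1 + t] *)

Lemma one_add_inv (R : nzRingType) (t : R) : t * t = 0 ->
  (1 + t) * (1 - t) = 1 /\ (1 - t) * (1 + t) = 1.
Proof.
move=> tt0; split.
  by rewrite mulrDl mul1r mulrBr mulr1 tt0 subr0 subrK.
by rewrite mulrBl mul1r mulrDr mulr1 tt0 addr0 addrK.
Qed.

(** Passing from [t] to [- t] changes the sign of the part linear in [t], so the sum isolates
    [t * x * t]. *)
Lemma conj_sum (R : nzRingType) (x t : R) :
  (1 + t) * x * (1 - t) + (1 - t) * x * (1 + t)
    = (x + x) - (t * x * t + t * x * t).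
Proof.
have conjE s : (1 + s) * x * (1 - s) = x - s * x * s + (s * x - x * s).
  by rewrite mulrDl mul1r mulrBr mulr1 mulrDl opprD [- _ - _]addrC addrACA.
have := conjE (- t); rewrite opprK => ->; rewrite conjE.
rewrite !mulNr !mulrN !opprK addrACA [- (t * x) + _]addrC -[_ - t * x]opprB.
by rewrite subrr addr0 addrACA -opprD.
Qed.

(** * Sets of matrices with central products *)

Section Primeness.
Variables (F : fieldType) (n : nat).
Hypothesis Fchar : 2%N \notin [pchar F].
Local Notation E := (grassmann F).
Local Notation e := (grassmann_gen F).
Local Notation M := (matrix_alg E n).
Implicit Types (x y z w : M).

(** A product of nonzero matrices can vanish even when their entries share no generator, as for
    [E_00 E_11]. A central factor is scalar, and then some entry of the product is a single product
    in [E]. *)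
Lemma matrix_disjoint w : w != 0 -> exists Phi : {lrmorphism M -> M},
  forall z, in_center w \/ in_center z -> w * Phi z = 0 -> z = 0.
Proof.
move=> /matrix0Pn[i [j wij]].
have [phi phi_reg] := grassmann_disjoint Fchar wij.
have [Phi PhiE] := map_mx_lrmorphism n phi.
exists Phi => z; case=> [wC|zC] wz0.
  move: wij phi_reg; rewrite /= (central_entry i j wC).
  case: (i =P j) => [_ {}w0 phi_reg|]; last by rewrite /= mulr0n eqxx.
  apply/matrixP => k l; rewrite [RHS]mxE; apply: phi_reg.
  have := congr1 (fun v : M => v k l) wz0; rewrite [X in _ = X -> _]mxE => <-.
  rewrite [RHS]mxE (bigD1 k) //= big1 => [|m /negPf mk].
    by rewrite (central_entry k k wC) eqxx addr0 PhiE.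
  by rewrite (central_entry k m wC) eq_sym mk mul0r.
have z00 : z 0 0 = 0.
  apply: phi_reg; have := congr1 (fun v : M => v i j) wz0.
  rewrite [X in _ = X -> _]mxE => <-.
  rewrite [RHS]mxE (bigD1 j) //= big1 => [|m /negPf mj].
    by rewrite PhiE (central_entry j j zC) eqxx addr0.
  by rewrite PhiE (central_entry m j zC) mj rmorph0 mulr0.
by apply/matrixP => k l; rewrite (central_entry k l zC) z00 mul0rn [RHS]mxE.
Qed.

(** They stand for the sets of values of [f] and [g]. *)
Variables X Y : M -> Prop.
Hypothesis Y_morph : forall (Phi : {lrmorphism M -> M}) y, Y y -> Y (Phi y).
Hypothesis XY_central : forall x y, X x -> Y y -> in_center (x * y).
Hypothesis X_neq0 : exists2 x, X x & x != 0.
Hypothesis Y_neq0 : exists2 y, Y y & y != 0.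

(** The group [L], determined by [Y] alone; it contains [X] by [XY_central]. *)
Definition left_central x := forall y, Y y -> in_center (x * y).

Lemma left_centralD x w :
  left_central x -> left_central w -> left_central (x + w).
Proof. by move=> xY wY y Yy c; rewrite mulrDl mulrDl mulrDr xY ?wY. Qed.

Lemma left_centralN x : left_central x -> left_central (- x).
Proof. by move=> xY y Yy c; rewrite !mulNr mulrN xY. Qed.

(** With [u = 1 + t] and [v] its inverse, [u x v y = u (x (v y u)) v]. As [v y u] is again in [Y],
    the inner factor is central and the outer conjugation fixes it. *)
Lemma left_centralJ x t : t * t = 0 -> left_central x ->
  left_central ((1 + t) * x * (1 - t)).
Proof.
move=> /one_add_inv[uv vu] xY y Yy.
have [phi phiE] := conj_lrmorphism vu uv.
suff -> : (1 + t) * x * (1 - t) * y = x * phi y by apply/xY/Y_morph.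
have xyC := xY _ (Y_morph phi Yy).
rewrite -[RHS]mulr1 -uv mulrA (xyC (1 + t)) phiE !mulrA.
by rewrite -[RHS]mulrA uv mulr1.
Qed.

(** [z] annihilates [Phi (y c - c y)], because both [z] and [z * Phi y] are central; the choice of
    [Phi] then makes the commutator vanish. *)
Lemma right_central_of_left z : z != 0 -> in_center z -> left_central z ->
  forall y, Y y -> in_center y.
Proof.
move=> z0 zC zY y Yy c; have [Phi z_reg] := matrix_disjoint z0.
apply/eqP; rewrite -subr_eq0; apply/eqP/z_reg; first by left.
rewrite rmorphB !rmorphM /= mulrBr mulrA (zY _ (Y_morph Phi Yy)).
by rewrite !mulrA zC subrr.
Qed.

(** A nonzero commutator [x c - c x] would annihilate [Phi y] for a nonzero central [y], against the
    choice of [Phi]. *)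
Lemma left_central_of_right : (forall y, Y y -> in_center y) ->
  forall x, left_central x -> in_center x.
Proof.
move=> YC x xY c; have [y Yy y0] := Y_neq0.
apply/eqP; rewrite -subr_eq0; apply: contraNT y0 => xc0.
have [Phi xc_reg] := matrix_disjoint xc0.
apply/eqP/xc_reg; first by right; apply: YC.
have PyC := YC _ (Y_morph Phi Yy).
rewrite mulrBl -!mulrA -(PyC c) !mulrA (xY _ (Y_morph Phi Yy)).
by rewrite !mulrA subrr.
Qed.

Lemma left_central_sandwich x t : t * t = 0 -> left_central x ->
  left_central (t * x * t + t * x * t).
Proof.
move=> tt0 xY.
have tt0' : - t * - t = 0 by rewrite mulrNN.
have conj1 := left_centralJ tt0 xY; have conj2 := left_centralJ tt0' xY.
have := left_centralN (left_centralD (left_centralD conj1 conj2)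
          (left_centralN (left_centralD xY xY))).
by rewrite opprK conj_sum addrAC subrr add0r opprK.
Qed.

(** Once [t * x * t] vanishes, conjugation by [1 + t] changes [x] exactly by the commutator. *)
Lemma left_central_bracket x t : t * t = 0 -> t * x * t = 0 ->
  left_central x -> left_central (t * x - x * t).
Proof.
move=> tt0 txt0 xY.
have := left_centralD (left_centralJ tt0 xY) (left_centralN xY).
congr left_central.
by rewrite mulrBr mulr1 !mulrDl !mul1r txt0 addr0 addrAC [x + _]addrC addrK.
Qed.

Lemma left_central_offdiag x i j : i != j -> left_central x -> x j i = 0.
Proof.
move=> ij xY; apply/eqP; apply: contraT => xji.
have [y Yy y0] := Y_neq0.
have /matrix0Pn[k [l ykl]] := y0.
(* Conjugation by this transposition matrix moves the nonzero entry of [y] from row [k] to row [j],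
   the row that [E_ij] reads. *)
pose P : M := perm_mx (tperm j k).
have PP : P * P = 1.
  by rewrite -[LHS]perm_mxM tperm2 perm_mx1.
have [psi psiE] := conj_lrmorphism PP PP.
have psi_y : psi y j (tperm j k l) = y k l.
  rewrite psiE -[LHS]/((P *m y *m P) _ _) -row_permE /P.
  by rewrite -[X in perm_mx X]tpermV -col_permE !mxE tpermL tpermK.
pose a := x j i + x j i.
have a0 : a != 0 by apply: contraNneq xji => /(addrr_eq0 Fchar)->.
have [phi phi_reg] := grassmann_disjoint Fchar a0.
have [Phi PhiE] := map_mx_lrmorphism n phi.
pose t : M := elem_mx i j 1.
have tt0 : t * t = 0 by apply: elem_mx_sq; right.
have := left_central_sandwich tt0 xY (Y_morph Phi (Y_morph psi Yy)).
have txt : t * x * t = elem_mx i j (x j i).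
  by rewrite -[LHS]/(t *m x *m t) elem_mx_sandwich mul1r mulr1.
rewrite txt; set z := _ * Phi _ => zC.
have zE r c : z r c = (a * phi (psi y j c)) *+ (r == i).
  rewrite /z mulrDl mxE [X in X + X]mul_elem_mx -mulrnDl -mulrDl.
  by rewrite PhiE.
(* Only row [i] of [z] can be nonzero, so its diagonal entry at [j] vanishes, while a central matrix
   has constant diagonal. *)
have z00 : z 0 0 = 0.
  have := central_entry j j zC; rewrite eqxx mulr1n => <-.
  by rewrite zE eq_sym (negPf ij).
case/eqP: ykl; rewrite -psi_y; apply: phi_reg.
have := central_entry i (tperm j k l) zC.
by rewrite z00 mul0rn zE eqxx.
Qed.

Lemma left_central_in_center x : left_central x -> in_center x.
Proof.
move=> xY.
have x_offdiag i j : x i j = x i i *+ (i == j).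
  have [-> //|ij] := eqVneq i j.
  by apply: (left_central_offdiag _ xY); rewrite eq_sym.
(* Entry [(i, j)] of the commutator with [u E_ij] is [u x_jj - x_ii u]; as an off-diagonal entry of
   an element of [L], it is zero. *)
have x_diag i j u : i != j -> u * x j j = x i i * u.
  move=> ij; pose t : M := elem_mx i j u.
  have tt0 : t * t = 0 by apply: elem_mx_sq; right.
  have txt0 : t * x * t = 0.
    rewrite -[LHS]/(t *m x *m t) elem_mx_sandwich.
    rewrite (left_central_offdiag ij xY) mulr0 mul0r.
    by apply/matrixP => r c; rewrite !mxE mul0rn.
  have ji : j != i by rewrite eq_sym.
  have := left_central_offdiag ji (left_central_bracket tt0 txt0 xY).
  rewrite mxE [X in _ + X]mxE [X in X - _]mul_elem_mx.
  by rewrite [X in _ - X]mul_mx_elem !eqxx => /eqP; rewrite subr_eq0 => /eqP.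
have x_const i : x i i = x 0 0.
  by have [-> //|i0] := eqVneq i 0; rewrite -[RHS]mul1r (x_diag _ _ _ i0) mulr1.
have [xC|/existsNP[k xk]] := pselect (forall k, e k * x 0 0 = x 0 0 * e k).
  apply: (central_scalar (c := x 0 0)); first exact: grassmann_central.
  by move=> i j; rewrite x_offdiag x_const.
(* In size at least 2, [x_diag] with [u = e k] and the constant diagonal would make [x 0 0] commute
   with [e k]. *)
have ord_eq0 (i : 'I_n.+1) : i = 0.
  apply/eqP; apply: contraPT xk => i0; rewrite -(x_diag 0 i) 1?eq_sym //.
  by rewrite x_const.
pose t : M := elem_mx 0 0 (e k).
have tt0 : t * t = 0 by apply: elem_mx_sq; left; apply: grassmann_gen_sq.
have txt0 : t * x * t = 0.
  rewrite -[LHS]/(t *m x *m t) elem_mx_sandwich grassmann_gen_sandwich //.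
  by apply/matrixP => r c; rewrite !mxE mul0rn.
have bY := left_central_bracket tt0 txt0 xY.
have bE i j : (t * x - x * t) i j = e k * x 0 0 - x 0 0 * e k.
  rewrite mxE [X in _ + X]mxE [X in X - _]mul_elem_mx.
  by rewrite [X in _ - X]mul_mx_elem (ord_eq0 i) (ord_eq0 j) !eqxx.
have b0 : t * x - x * t != 0.
  by apply/matrix0Pn; exists 0, 0; rewrite bE subr_eq0; apply/eqP.
have bC : in_center (t * x - x * t).
  apply: (central_scalar (grassmann_bracket_central (x 0 0) k)) => i j.
  by rewrite bE (ord_eq0 i) (ord_eq0 j) eqxx.
exact: left_central_of_right (right_central_of_left b0 bC bY) _ xY.
Qed.

Lemma both_central :
  (forall x, X x -> in_center x) /\ (forall y, Y y -> in_center y).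
Proof.
have XC x : X x -> in_center x.
  by move=> Xx; apply: left_central_in_center => y; apply: XY_central.
split=> //; have [x Xx x0] := X_neq0.
apply: (right_central_of_left x0 (XC _ Xx)) => y; exact: XY_central.
Qed.

End Primeness.

(** * Application to the values of two polynomials *)

Theorem corollary4p14 (F : fieldType) (n : nat)
    (Finf : infinite_set [set: F]%classic)
    (Fchar : 2%N \notin [pchar F]%R) :
  primeness_central (matrix_alg (grassmann F) n).
Proof.
move=> r s f g Df Dg [fg_nid fg_central].
pose M := matrix_alg (grassmann F) n.
pose values h := fun x : M => exists a, x = free_eval a h.
(* As the variables are distinct, two assignments can be glued: every product of a value of [f] and
   a value of [g] is a value of [f * g]. *)
have fg_eval a b : free_eval (fun i => if (i < r)%N then a i else b i) (f * g)
    = free_eval a f * free_eval b g :> M.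
  rewrite free_evalM; congr (_ * _).
    by apply: (eq_free_eval Df) => i; rewrite unfold_in => ->.
  apply: (eq_free_eval Dg) => i; rewrite unfold_in => /andP[].
  by rewrite leqNgt => /negPf->.
have values_morph h (Phi : {lrmorphism M -> M}) x :
  values h x -> values h (Phi x).
  by move=> [a ->]; exists (Phi \o a); rewrite free_eval_morph.
(* A point where the product is nonzero provides nonzero values of both factors. *)
have [c fgc0] : exists c : nat -> M, free_eval c (f * g) != 0.
  apply: contrapT => fg0; apply: fg_nid => c; apply/eqP.
  by apply: contraT => fgc0; case: fg0; exists c.
rewrite free_evalM in fgc0.
have fc0 : free_eval c f != 0 by apply: contraNneq fgc0 => ->; rewrite mul0r.
have gc0 : free_eval c g != 0 by apply: contraNneq fgc0 => ->; rewrite mulr0.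
have values_neq0 h :
    free_eval c h != 0 :> M -> exists2 x, values h x & x != 0.
  by move=> hc0; exists (free_eval c h); [exists c | exact: hc0].
have [|||fC gC] :=
  @both_central F n Fchar (values f) (values g) (values_morph g).
- by move=> _ _ [a ->] [b ->]; rewrite -fg_eval; apply: fg_central.
- exact: values_neq0 fc0.
- exact: values_neq0 gc0.
split; split.
- by move=> /(_ c)/eqP; apply/negP: fc0.
- by move=> a; apply: fC; exists a.
- by move=> /(_ c)/eqP; apply/negP: gc0.
- by move=> a; apply: gC; exists a.
Qed.
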